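(* Let $(X,d)$ be a complete $b$-rectangular metric space with coefficient $s>1$ and let $T:X\to X$ be a $(\phi,F)$-Reich-type $(\Im)$ contraction, i.e. there exist functions $F:(0,+\infty)\to\mathbb{R}$ and $\phi:(0,+\infty)\to(0,+\infty)$ satisfying conditions (i)--(iv) listed in the context such that for all $x,y\in X$ with $d(Tx,Ty)>0$, $$F\big(s^2d(Tx,Ty)\big)+\phi\big(d(x,y)\big)\le F\left(\frac{d(x,y)+d(x,Tx)+d(y,Ty)}{3}\right).$$ Then $T$ has a unique fixed point.
   Context: A $b$-rectangular metric space with coefficient $s\ge 1$ is a nonempty set $X$ with a map $d:X\times X\to[0,+\infty)$ such that for all $x,y\in X$ and all distinct points $u,v\in X$, each distinct from $x$ and $y$: (1) $d(x,y)=0$ if and only if $x=y$; (2) $d(x,y)=d(y,x)$; (3) $d(x,y)\le s[d(x,u)+d(u,v)+d(v,y)]$. A sequence $(x_n)$ converges to $x$ if $d(x_n,x)\to 0$; it is Cauchy if $d(x_n,x_m)\to 0$ as $n,m\to\infty$; the space is complete if every Cauchy sequence converges to some point of $X$. Conditions on $F$ and $\phi$: (i) $F$ is strictly increasing; (ii) for each sequence $(x_n)$ of positive numbers, $\lim_{n\to\infty}x_n=0$ if and only if $\lim_{n\to\infty}F(x_n)=-\infty$; (iii) $\liminf_{u\to\alpha^+}\phi(u)>0$ for all $\alpha>0$; (iv) $F$ is continuous. *)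

(* Defs.v *)
From mathcomp Require Import all_boot all_order all_algebra.
From mathcomp Require Import all_classical all_reals all_analysis.
Import Order.TTheory GRing.Theory Num.Theory.
Import numFieldNormedType.Exports.

Set Implicit Arguments.
Unset Strict Implicit.
Unset Printing Implicit Defensive.

Local Open Scope classical_set_scope.
Local Open Scope ring_scope.

Record b_rectangular_metric (R : realType) (X : Type) (s : R)
    (d : X -> X -> R) : Prop := {
  brm_coef : 1 <= s;
  brm_nonempty : inhabited X;
  brm_ge0 : forall x y, 0 <= d x y;
  brm_eq0 : forall x y, d x y = 0 <-> x = y;
  brm_sym : forall x y, d x y = d y x;
  brm_rectangular : forall x y u v,
    u <> v -> u <> x -> u <> y -> v <> x -> v <> y ->
    d x y <= s * (d x u + d u v + d v y)
}.

(* A b-rectangular metric need not be continuous and its balls need not be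
   open, so convergence and Cauchyness are stated on d itself instead of
   through a topology on X. *)
Definition brm_converges (R : realType) (X : Type) (d : X -> X -> R)
    (x_ : nat -> X) (x : X) : Prop :=
  d (x_ n) x @[n --> \oo] --> (0 : R).

Definition brm_cauchy (R : realType) (X : Type) (d : X -> X -> R)
    (x_ : nat -> X) : Prop :=
  d (x_ p.1) (x_ p.2) @[p --> (\oo, \oo)] --> (0 : R).

Definition brm_complete (R : realType) (X : Type) (d : X -> X -> R) : Prop :=
  forall x_ : nat -> X, brm_cauchy d x_ -> exists x, brm_converges d x_ x.

(* F : (0, +oo) -> R and phi : (0, +oo) -> (0, +oo) are represented by total
   functions on R; every condition only involves their values on (0, +oo). *)
Record phiF_conditions (R : realType) (F phi : R -> R) : Prop := {
  phiF_phi_gt0 : forall u : R, 0 < u -> 0 < phi u;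
  phiF_F_incr : forall u v : R, 0 < u -> u < v -> F u < F v;
  phiF_F_lim : forall u_ : nat -> R, (forall n, 0 < u_ n) ->
    (u_ n @[n --> \oo] --> (0 : R)) <-> (F (u_ n) @[n --> \oo] --> -oo);
  phiF_phi_liminf : forall a : R, 0 < a ->
    (0 < limf_einf (fun u => (phi u)%:E) a^'+)%E;
  phiF_F_cont : forall u : R, 0 < u -> {for u, continuous F}
}.

Definition phiF_Reich_contraction (R : realType) (X : Type) (s : R)
    (d : X -> X -> R) (T : X -> X) : Prop :=
  exists F phi : R -> R, phiF_conditions F phi /\
    forall x y, 0 < d (T x) (T y) ->
      F (s ^+ 2 * d (T x) (T y)) + phi (d x y)
        <= F ((d x y + d x (T x) + d y (T y)) / 3).

(* Main.v *)
(** Since [phi > 0] and [F] is increasing, the hypothesis gives the linear Reich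
    inequality [3 s^2 d(Tx,Ty) <= d(x,y) + d(x,Tx) + d(y,Ty)].  It makes
    [e_n = d(x_n, x_(n+1))] decay geometrically along an orbit, so an orbit
    without fixed point is injective and the rectangular inequality applies to
    its points.  The path [x, Tx, Ty, y] then gives
    [(3 s - 1) d(x,y) <= (3 s^2 + 1) (d(x,Tx) + d(y,Ty))], hence orbits are
    Cauchy; the path [z, x_n, x_(n+1), Tz] shows that the limit [z] is fixed. *)
Require Import Defs.
From mathcomp Require Import all_boot all_order all_algebra.
From mathcomp Require Import all_classical all_reals all_analysis.
From mathcomp Require Import zify lra.
Import Order.TTheory GRing.Theory Num.Theory.
Import numFieldNormedType.Exports.
Local Open Scope ring_scope.

Set Implicit Arguments.
Unset Strict Implicit.
Unset Printing Implicit Defensive.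

Definition Reich_inequality (R : realType) (X : Type) (s : R) (d : X -> X -> R)
    (T : X -> X) : Prop :=
  forall x y, 3 * s ^+ 2 * d (T x) (T y) <= d x y + d x (T x) + d y (T y).

Lemma brm_gt0 (R : realType) (X : Type) (s : R) (d : X -> X -> R)
    (hd : b_rectangular_metric s d) (x y : X) : x <> y -> 0 < d x y.
Proof.
move=> xy; rewrite lt_neqAle (brm_ge0 hd) andbT eq_sym.
by apply/eqP => /(brm_eq0 hd).
Qed.

(** If it failed, monotonicity of [F] would put [F (s ^+ 2 * d (T x) (T y))] above [F] of the mean,
    while the contraction puts it below by [phi (d x y) > 0]. *)
Lemma phiF_Reich_inequality (R : realType) (X : Type) (s : R) (d : X -> X -> R)
    (T : X -> X) (hd : b_rectangular_metric s d)
    (hT : phiF_Reich_contraction s d T) : Reich_inequality s d T.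
Proof.
move: hT => [F [phi [hF hT]]] x y.
have [dxy dx dy] : [/\ 0 <= d x y, 0 <= d x (T x) & 0 <= d y (T y)].
  by split; exact: brm_ge0 hd _ _.
have [dT0|dT0] := leP (d (T x) (T y)) 0.
  have -> : d (T x) (T y) = 0 by apply/eqP; rewrite eq_le dT0 (brm_ge0 hd).
  by rewrite mulr0 !addr_ge0.
(* Distinctness makes [d x y] positive, so that [phi (d x y) > 0] and the mean lies in the domain of
   [F]. *)
have xy : x <> y by move=> xy; move: dT0; rewrite xy ((brm_eq0 hd _ _).2 erefl) ltxx.
have dxy0 := brm_gt0 hd xy.
have phi0 := phiF_phi_gt0 hF dxy0.
have [//|lt] := leP.
have M0 : 0 < (d x y + d x (T x) + d y (T y)) / 3 by lra.
have := phiF_F_incr hF M0 (v := s ^+ 2 * d (T x) (T y)).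
have := hT x y dT0.
have -> : (d x y + d x (T x) + d y (T y)) / 3 < s ^+ 2 * d (T x) (T y) by lra.
move=> h /(_ isT); lra.
Qed.

Lemma near_infty_inj_neq (X : Type) (f : nat -> X) (a : X) :
  injective f -> (\forall n \near \oo, f n <> a)%classic.
Proof.
move=> finj; have [[k fk]|nk] := pselect (exists k, f k = a).
  near=> n; rewrite -fk => /finj nk.
  suff : (k < n)%N by rewrite nk ltnn.
  by near: n; exact: nbhs_infty_gt.
by near=> n; move=> fn; apply: nk; exists n.
Unshelve. all: by end_near. Qed.

(** At the pair [x], [T x], the distance [d (T x) (T (T x))] is on both sides; absorbing it on the
    left leaves the factor [3 s^2 - 1], which exceeds 2. *)
Lemma Reich_step (R : realType) (X : Type) (s : R) (d : X -> X -> R)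
    (T : X -> X) (hs : 1 < s) (hR : Reich_inequality s d T) (x : X) :
  d (T x) (T (T x)) <= 2 / (3 * s ^+ 2 - 1) * d x (T x).
Proof.
have s2 : 1 < s ^+ 2 by rewrite exprn_egt1.
rewrite mulrAC ler_pdivlMr; last by lra.
have := hR x (T x); lra.
Qed.

Lemma Reich_orbit_step_le (R : realType) (X : Type) (s : R) (d : X -> X -> R)
    (T : X -> X) (hs : 1 < s) (hR : Reich_inequality s d T) (x : X) (n : nat) :
  d (iter n T x) (iter n.+1 T x) <= d x (T x) * (2 / (3 * s ^+ 2 - 1)) ^+ n.
Proof.
have s2 : 1 < s ^+ 2 by rewrite exprn_egt1.
elim: n => [|n IHn]; first by rewrite expr0 mulr1.
rewrite [_ ^+ n.+1]exprS mulrCA.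
apply: le_trans (Reich_step hs hR _) _.
by rewrite ler_wpM2l // divr_ge0 //; lra.
Qed.

Lemma Reich_orbit_step_cvg (R : realType) (X : Type) (s : R) (d : X -> X -> R)
    (T : X -> X) (hd : b_rectangular_metric s d) (hs : 1 < s)
    (hR : Reich_inequality s d T) (x : X) :
  (d (iter n T x) (iter n.+1 T x) @[n --> \oo] --> (0 : R))%classic.
Proof.
have s2 : 1 < s ^+ 2 by rewrite exprn_egt1.
apply: (@squeeze_cvgr _ _ _ _ (cst 0)
  (fun n => d x (T x) * (2 / (3 * s ^+ 2 - 1)) ^+ n)).
- apply: nearW => n /=.
  by rewrite (brm_ge0 hd) (Reich_orbit_step_le hs hR).
- exact: cvg_cst.
- apply: cvg_geometric; rewrite ger0_norm; last by rewrite divr_ge0 //; lra.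
  rewrite ltr_pdivrMr; lra.
Qed.

(** Without fixed points the consecutive distances strictly decrease, while equal iterates would
    have equal consecutive distances. *)
Lemma Reich_orbit_inj (R : realType) (X : Type) (s : R) (d : X -> X -> R)
    (T : X -> X) (hd : b_rectangular_metric s d) (hs : 1 < s)
    (hR : Reich_inequality s d T) (nofix : forall x, T x <> x) (x : X) :
  injective (fun n => iter n T x).
Proof.
have s2 : 1 < s ^+ 2 by rewrite exprn_egt1.
have decr : {homo (fun n => d (iter n T x) (iter n.+1 T x)) :
    m n / (m < n)%N >-> n < m}.
  apply: homo_ltn => [? ? ? /[swap]|n /=]; first exact: lt_trans.
  apply: le_lt_trans (Reich_step hs hR _) _.
  rewrite gtr_pMl; first by rewrite ltr_pdivrMr; lra.
  by apply: (brm_gt0 hd) => /esym; exact: nofix.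
move=> m n /= mn.
by have [/decr /=|/decr /=|//] := ltngtP m n; rewrite mn ltxx.
Qed.

Lemma Reich_dist_le (R : realType) (X : Type) (s : R) (d : X -> X -> R)
    (T : X -> X) (hd : b_rectangular_metric s d) (hs : 1 < s)
    (hR : Reich_inequality s d T) (x y : X) :
  T x <> T y -> T x <> x -> T x <> y -> T y <> x -> T y <> y ->
  d x y <= (3 * s ^+ 2 + 1) / (3 * s - 1) * (d x (T x) + d y (T y)).
Proof.
move=> TxTy Txx Txy Tyx Tyy.
rewrite mulrAC ler_pdivlMr; last by lra.
have := brm_rectangular hd TxTy Txx Txy Tyx Tyy.
(* Scaling by [3 * s] produces the term [3 s^2 d(Tx,Ty)] that the Reich inequality bounds; the
   resulting [d x y] is absorbed on the left. *)
rewrite (brm_sym hd (T y) y) -(ler_pM2l (_ : 0 < 3 * s)); last by lra.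
have := hR x y; lra.
Qed.

Lemma Reich_orbit_cauchy (R : realType) (X : Type) (s : R) (d : X -> X -> R)
    (T : X -> X) (hd : b_rectangular_metric s d) (hs : 1 < s)
    (hR : Reich_inequality s d T) (nofix : forall x, T x <> x) (x : X) :
  brm_cauchy d (fun n => iter n T x).
Proof.
pose e n := d (iter n T x) (iter n.+1 T x).
pose C := (3 * s ^+ 2 + 1) / (3 * s - 1).
(* This covers consecutive indices, where the path degenerates and the distance is a single
   [e m]. *)
have C1 : 1 <= C by rewrite ler_pdivlMr; nra.
have e0 n : 0 <= e n by exact: brm_ge0 hd _ _.
have inj := Reich_orbit_inj hd hs hR nofix (x := x).
have neq i j : i <> j -> iter i T x <> iter j T x by move=> ij /inj.
have dle m n : d (iter m T x) (iter n T x) <= C * (e m + e n).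
  have [->|mn] := eqVneq m n.
    by rewrite ((brm_eq0 hd _ _).2 erefl) mulr_ge0 ?addr_ge0 //; lra.
  have [->|Smn] := eqVneq n m.+1.
    by rewrite -/(e m); have := e0 m; have := e0 m.+1; nra.
  have [->|mSn] := eqVneq m n.+1.
    by rewrite (brm_sym hd) -/(e n); have := e0 n; have := e0 n.+1; nra.
  have := Reich_dist_le hd hs hR (x := iter m T x) (y := iter n T x).
  rewrite -!iterS; apply; apply: neq; move: mn Smn mSn; lia.
have ecvg := Reich_orbit_step_cvg hd hs hR x.
apply: (@squeeze_cvgr _ _ _ _ (cst 0) (fun p => C * (e p.1 + e p.2))).
- by apply: nearW => p /=; rewrite (brm_ge0 hd) dle.
- exact: cvg_cst.
- rewrite -(mulr0 C); apply: cvgMl_tmp; rewrite -(addr0 0).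
  by apply: cvgD; apply: (cvg_comp _ _ _ ecvg); [exact: cvg_fst|exact: cvg_snd].
Qed.

Lemma Reich_orbit_limit_fixed (R : realType) (X : Type) (s : R)
    (d : X -> X -> R) (T : X -> X) (hd : b_rectangular_metric s d) (hs : 1 < s)
    (hR : Reich_inequality s d T) (x z : X) :
  injective (fun n => iter n T x) ->
  brm_converges d (fun n => iter n T x) z -> T z = z.
Proof.
move=> inj xz; pose e n := d (iter n T x) (iter n.+1 T x).
have ecvg := Reich_orbit_step_cvg hd hs hR x.
(* The bound involves only [d (iter n T x) z] and [e n], which tend to 0, so no continuity of [d] is
   invoked. *)
suff : (3 * s - 1) * d z (T z) <= 0.
  rewrite pmulr_rle0; last by lra.
  by move=> zTz; apply/esym/(brm_eq0 hd)/eqP; rewrite eq_le zTz (brm_ge0 hd).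
have cvg0 : ((3 * s ^+ 2 + 1) * (d (iter n T x) z + e n) @[n --> \oo]
    --> (0 : R))%classic.
  rewrite -(mulr0 (3 * s ^+ 2 + 1)); apply: cvgMl_tmp.
  by rewrite -(addr0 0); apply: cvgD.
have injS : injective (fun n => iter n.+1 T x) by move=> i j /inj [].
apply: (cvgr_to_ge cvg0); near=> n.
have uv : iter n T x <> iter n.+1 T x by move/inj; lia.
(* An injective orbit meets [z] and [T z] at most once each, so the path has distinct points for
   large [n]. *)
have [uz uTz] : iter n T x <> z /\ iter n T x <> T z.
  by split; near: n; exact: near_infty_inj_neq.
have [vz vTz] : iter n.+1 T x <> z /\ iter n.+1 T x <> T z.
  by split; near: n; exact: near_infty_inj_neq injS.
have := brm_rectangular hd uv uz uTz vz vTz.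
rewrite (brm_sym hd z (iter n T x)) -/(e n) -(ler_pM2l (_ : 0 < 3 * s)); last by lra.
have := hR (iter n T x) z; rewrite -iterS -/(e n); lra.
Unshelve. all: by end_near. Qed.

Theorem theorem3p8 (R : realType) (X : Type) (s : R) (d : X -> X -> R)
    (T : X -> X) (hd : b_rectangular_metric s d) (hs : 1 < s)
    (hcomplete : brm_complete d) (hT : phiF_Reich_contraction s d T) :
  exists! x : X, T x = x.
Proof.
have hR := phiF_Reich_inequality hd hT.
have [z Tz] : exists z, T z = z.
  apply: contrapT => /forallNP nofix.
  have [x] := brm_nonempty hd.
  have [z xz] := hcomplete _ (Reich_orbit_cauchy hd hs hR nofix x).
  apply: (nofix z); apply: (Reich_orbit_limit_fixed hd hs hR (x := x)) => //.
  exact: (Reich_orbit_inj hd hs hR nofix (x := x)).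
exists z; split=> // y Ty; apply/(brm_eq0 hd)/eqP; rewrite eq_le (brm_ge0 hd) andbT.
have s2 : 1 < s ^+ 2 by rewrite exprn_egt1.
(* For two fixed points the inequality reads [3 s^2 d(z,y) <= d(z,y)], forcing distance 0. *)
have := hR z y; rewrite Tz Ty !((brm_eq0 hd _ _).2 erefl).
have := brm_ge0 hd z y; nra.
Qed.
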